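(* Let $\mathcal{A}\subset\mathbb{R}^d$ be a finite set affinely spanning $\mathbb{R}^d$, let $w=(w_{\mathbf a}\mid\mathbf a\in\mathcal{A})\in\mathbb{R}^{\mathcal{A}}_>$, and let $\mathcal{B}=\{\mathbf b_{\mathbf a}\mid\mathbf a\in\mathcal{A}\}\subset\mathbb{R}^n$ (with $d\le n$) be exponents, weights and control points for a toric B\'ezier patch. Let $\Delta$ be the convex hull of $\mathcal{A}$ and let $\beta_{\mathbf a}$, $\mathbf a\in\mathcal{A}$, be toric B\'ezier functions for $\mathcal{A}$. Suppose that $\mathcal{T}$ is a regular triangulation of $\mathcal{A}$ induced by a lifting function $\lambda\colon\mathcal{A}\to\mathbb{R}$. For each $t>0$, let $F_t\colon\Delta\to\mathbb{R}^n$ be the toric B\'ezier patch of shape $\mathcal{A}$ with control points $\mathcal{B}$ and weights $t^{\lambda(\mathbf a)}w_{\mathbf a}$, that is, $$F_t(x)=\frac{\sum_{\mathbf a\in\mathcal{A}} t^{\lambda(\mathbf a)}w_{\mathbf a}\,\beta_{\mathbf a}(x)\,\mathbf b_{\mathbf a}}{\sum_{\mathbf a\in\mathcal{A}} t^{\lambda(\mathbf a)}w_{\mathbf a}\,\beta_{\mathbf a}(x)}.$$ Then for any $\epsilon>0$ there exists a $t_0$ such that if $t>t_0$, the image $F_t(\Delta)$ lies within $\epsilon$ of the regular control polytope $\mathcal{B}(\mathcal{T})$, i.e. every point of $F_t(\Delta)$ is within Euclidean distance $\epsilon$ of some point of $\mathcal{B}(\mathcal{T})$.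
   Context: $\mathbb{R}_>$ denotes the positive real numbers; $\mathbb{R}^{\mathcal{A}}_>$ is the set of vectors indexed by $\mathcal{A}$ with all coordinates strictly positive. Toric B\'ezier functions: write $\Delta=\{x\in\mathbb{R}^d\mid h_i(x)\ge 0,\ i=1,\dots,\ell\}$, where $\Delta$ has $\ell$ facets and the $i$th facet is supported by the hyperplane $h_i(x)=0$, with $h_i(x)=\mathbf v_i\cdot x+c_i$, $c_i\in\mathbb{R}$ and $\mathbf v_i$ an inward-pointing normal vector to the $i$th facet (each pair $(\mathbf v_i,c_i)$ is chosen up to a positive scalar). For such a choice the toric B\'ezier functions for $\mathcal{A}$ are $\beta_{\mathbf a}(x)=h_1(x)^{h_1(\mathbf a)}\cdots h_\ell(x)^{h_\ell(\mathbf a)}$ for $\mathbf a\in\mathcal{A}$, $x\in\Delta$ (with $0^0=1$). They have no common zero on $\Delta$. Regular triangulation: for a lifting function $\lambda\colon\mathcal{A}\to\mathbb{R}$ let $P_\lambda\subset\mathbb{R}^{d+1}$ be the convex hull of the lifted points $\{(\mathbf a,\lambda(\mathbf a))\mid\mathbf a\in\mathcal{A}\}$; it is assumed that $P_\lambda$ is full-dimensional (its affine span is $\mathbb{R}^{d+1}$). The upper facets of $P_\lambda$ are the facets whose outward-pointing normal vector has positive last coordinate. It is assumed that $\lambda$ is generic in that all upper facets of $P_\lambda$ are simplices; for each upper facet, the subset $\mathcal{A}_i\subset\mathcal{A}$ of those $\mathbf a$ whose lifted point $(\mathbf a,\lambda(\mathbf a))$ lies on that facet then consists of $d+1$ elements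 and spans a $d$-dimensional simplex. The collection $\mathcal{T}=\{\mathcal{A}_i\mid i=1,\dots,m\}$ of these subsets, one per upper facet, is the regular triangulation of $\mathcal{A}$ induced by $\lambda$; the simplices $\mathrm{conv}(\mathcal{A}_i)$ cover $\Delta$ and any two that intersect meet along a common face. Not every point of $\mathcal{A}$ need belong to some $\mathcal{A}_i$. Regular control polytope: $\mathcal{B}(\mathcal{T})=\bigcup_{i=1}^m \mathrm{conv}\{\mathbf b_{\mathbf a}\mid\mathbf a\in\mathcal{A}_i\}\subset\mathbb{R}^n$ (a union of possibly degenerate simplices). *)

(* Defs.v *)
From HB Require Import structures.
From mathcomp Require Import all_boot all_order all_algebra.
From mathcomp Require Import finmap.
From mathcomp Require Import all_classical all_reals all_analysis.

Set Implicit Arguments.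
Unset Strict Implicit.
Unset Printing Implicit Defensive.

Import Order.TTheory GRing.Theory Num.Theory.
Import numFieldNormedType.Exports.

Local Open Scope classical_set_scope.
Local Open Scope ring_scope.

Definition dotv (R : realType) (k : nat) (v x : 'rV[R]_k) : R :=
  \sum_(j < k) v 0 j * x 0 j.

(* The library norm on 'rV[R]_k is the sup norm, hence this definition. *)
Definition euclid_dist (R : realType) (k : nat) (x y : 'rV[R]_k) : R :=
  Num.sqrt (dotv (x - y) (x - y)).

Definition affine_hull (R : realType) (k : nat) (S : set 'rV[R]_k) :
    set 'rV[R]_k :=
  [set x | exists (m : nat) (p : 'I_m -> 'rV[R]_k) (r : 'I_m -> R),
     [/\ forall i, S (p i),
         \sum_(i < m) r i = 1
       & x = \sum_(i < m) r i *: p i]].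

Definition convex_hull (R : realType) (k : nat) (S : set 'rV[R]_k) :
    set 'rV[R]_k :=
  [set x | exists (m : nat) (p : 'I_m -> 'rV[R]_k) (r : 'I_m -> R),
     [/\ forall i, S (p i),
         forall i, 0 <= r i,
         \sum_(i < m) r i = 1
       & x = \sum_(i < m) r i *: p i]].

Definition affine_indep (R : realType) (k m : nat) (p : 'I_m -> 'rV[R]_k) :=
  forall r : 'I_m -> R,
    \sum_(i < m) r i = 0 -> \sum_(i < m) r i *: p i = 0 ->
    forall i, r i = 0.

Definition has_dim (R : realType) (k : nat) (S : set 'rV[R]_k) (m : nat) :=
  exists p : 'I_m.+1 -> 'rV[R]_k,
    [/\ affine_indep p, forall i, S (p i) & S `<=` affine_hull (range p)].

Definition is_simplex (R : realType) (k m : nat) (S : set 'rV[R]_k) :=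
  exists p : 'I_m.+1 -> 'rV[R]_k,
    affine_indep p /\ S = convex_hull (range p).

Definition affine_form (R : realType) (k : nat) (v : 'rV[R]_k) (c : R)
    (x : 'rV[R]_k) : R :=
  dotv v x + c.

Definition hyperplane (R : realType) (k : nat) (v : 'rV[R]_k) (c : R) :
    set 'rV[R]_k :=
  [set x | affine_form v c x = 0].

(* F is a facet of the polytope P, supported by the hyperplane v.x + c = 0,
   and v points to the side of that hyperplane on which P lies. *)
Definition facet_inward (R : realType) (k : nat) (P F : set 'rV[R]_k)
    (v : 'rV[R]_k) (c : R) :=
  [/\ v != 0,
      forall x, P x -> 0 <= affine_form v c x,
      F = P `&` hyperplane v c
    & exists2 m : nat, has_dim P m.+1 & has_dim F m].

Definition is_facet (R : realType) (k : nat) (P F : set 'rV[R]_k) :=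
  exists v c, facet_inward P F v c.

Definition facet_outward_normal (R : realType) (k : nat)
    (P F : set 'rV[R]_k) (u : 'rV[R]_k) :=
  exists c, facet_inward P F (- u) c.

Definition polytope (R : realType) (d : nat) (A : {fset 'rV[R]_d}) :
    set 'rV[R]_d :=
  convex_hull [set` A].

(* The forms h_i = v_i . x + c_i, i < l, list the facets of P, each once. *)
Record facet_forms (R : realType) (d : nat) (P : set 'rV[R]_d) (l : nat)
    (v : 'I_l -> 'rV[R]_d) (c : 'I_l -> R) : Prop := FacetForms {
  facet_forms_eq :
    P = [set x | forall i, 0 <= affine_form (v i) (c i) x];
  facet_forms_facet : forall i,
    facet_inward P (P `&` hyperplane (v i) (c i)) (v i) (c i);
  facet_forms_inj : injective (fun i => P `&` hyperplane (v i) (c i));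
  facet_forms_surj : forall F, is_facet P F ->
    exists i, F = P `&` hyperplane (v i) (c i) }.

(* powR satisfies 0 `^ 0 = 1 and 0 `^ r = 0 for r != 0. *)
Definition toric_bezier (R : realType) (d : nat) (A : {fset 'rV[R]_d})
    (l : nat) (v : 'I_l -> 'rV[R]_d) (c : 'I_l -> R)
    (a : A) (x : 'rV[R]_d) : R :=
  \prod_(i < l)
    (affine_form (v i) (c i) x) `^ (affine_form (v i) (c i) (val a)).

Definition toric_patch (R : realType) (d n : nat) (A : {fset 'rV[R]_d})
    (beta : A -> 'rV[R]_d -> R) (w : A -> R) (b : A -> 'rV[R]_n)
    (x : 'rV[R]_d) : 'rV[R]_n :=
  (\sum_(a : A) w a * beta a x)^-1 *: \sum_(a : A) (w a * beta a x) *: b a.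

Definition lift_point (R : realType) (d : nat) (A : {fset 'rV[R]_d})
    (lam : A -> R) (a : A) : 'rV[R]_(d + 1) :=
  row_mx (val a) (lam a)%:M.

Definition lifted_polytope (R : realType) (d : nat) (A : {fset 'rV[R]_d})
    (lam : A -> R) : set 'rV[R]_(d + 1) :=
  convex_hull (range (lift_point lam)).

Definition upper_facet (R : realType) (d : nat) (P F : set 'rV[R]_(d + 1)) :=
  exists u : 'rV[R]_(d + 1),
    facet_outward_normal P F u /\ 0 < u 0 (rshift d ord0).

Definition points_on (R : realType) (d : nat) (A : {fset 'rV[R]_d})
    (lam : A -> R) (F : set 'rV[R]_(d + 1)) : set A :=
  [set a | F (lift_point lam a)].

Record regular_triangulation (R : realType) (d : nat) (A : {fset 'rV[R]_d})
    (lam : A -> R) (T : set (set A)) : Prop := RegularTriangulation {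
  regular_full_dim : affine_hull (lifted_polytope lam) = setT;
  regular_simplex : forall F, upper_facet (lifted_polytope lam) F ->
    is_simplex d F;
  (* no point of A other than the vertices of F is lifted into F *)
  regular_card : forall F, upper_facet (lifted_polytope lam) F ->
    (points_on lam F #= `I_d.+1)%card;
  regular_sets : T = [set S | exists2 F,
    upper_facet (lifted_polytope lam) F & S = points_on lam F] }.

Definition control_polytope (R : realType) (d n : nat) (A : {fset 'rV[R]_d})
    (b : A -> 'rV[R]_n) (T : set (set A)) : set 'rV[R]_n :=
  \bigcup_(S in T) convex_hull (b @` S).

(* Main.v *)
(* Let q_a = t^lam(a) w_a beta_a(x), Q their sum, and let L be the set of those
   a with q_a >= e Q.  By Farkas' lemma, one of two things happens.
   - Some affine form is nonnegative on all lifted points, vanishes at those of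
     L and decreases upwards.  Pushing its hyperplane against further lifted
     points turns it into the supporting form of an upper facet, so L lies in a
     cell of the triangulation, and moving the remaining weights (each smaller
     than e Q) to a vertex of that cell changes F_t(x) by O(e).
   - There are r, s >= 0 with s supported on L, sum r = sum s,
     sum r_a a = sum s_a a and sum r_a lam(a) = sum s_a lam(a) + 1.  The products
     prod beta_a(x)^r_a and prod beta_a(x)^s_a agree, boundary points x
     included, so prod (q_a/Q)^r_a is t times a positive constant times
     prod (q_a/Q)^s_a; as the former is at most 1 and the latter at least
     e^(sum s), t is bounded by a constant independent of x. *)
Require Import Defs.
From mathcomp Require Import all_boot all_order all_algebra.
From mathcomp Require Import finmap ring lra.
From mathcomp Require Import all_classical all_reals all_analysis.

Set Implicit Arguments.
Unset Strict Implicit.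
Unset Printing Implicit Defensive.

Import Order.TTheory GRing.Theory Num.Theory.
Local Open Scope classical_set_scope.
Local Open Scope ring_scope.

(** * Farkas' lemma for finitely many linear forms *)

(** Induction on the list of constraints. If the constraint of the head [k] is redundant it gets
    coefficient 0. Otherwise a point satisfying the others but violating the conclusion has [f k]
    positive there, and projecting along it onto the kernel of [f k] removes that constraint. *)
Lemma farkas (R : realFieldType) (V : lmodType R) (I : eqType) (s : seq I)
    (f : I -> V -> R) (g : V -> R) :
  uniq s -> (forall i, scalar (f i)) -> scalar g ->
  (forall x, (forall i, i \in s -> f i x <= 0) -> g x <= 0) ->
  exists2 u : I -> R, forall i, 0 <= u i &
    forall x, g x = \sum_(i <- s) u i * f i x.
Proof.
have sc0 (h : V -> R) : scalar h -> h 0 = 0.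
  by move=> hl; have := hl (-1) 0 0; rewrite scaler0 addr0; lra.
have scZ (h : V -> R) : scalar h -> forall a x, h (a *: x) = a * h x.
  by move=> hl a x; have := hl a x 0; rewrite addr0 sc0 // addr0.
elim: s f g => [|k s IH] f g /=.
  move=> _ _ gl g0; exists (fun=> 0) => // x; rewrite big_nil; apply/eqP.
  rewrite eq_le g0 //= -oppr_le0 -mulN1r -scZ //.
  exact: g0.
move=> /andP[ks us] fl gl fg.
have [fg'|] := pselect (forall x, (forall i, i \in s -> f i x <= 0) -> g x <= 0).
  have [u u0 gE] := IH _ _ us fl gl fg'.
  exists (fun i => if i == k then 0 else u i) => [i|x]; first by case: eqP.
  rewrite big_cons eqxx mul0r add0r gE; apply: eq_big_seq => i si.
  by case: eqP => // ik; rewrite -ik si in ks.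
move=> /existsNP[x0' /not_implyP[fx0' /negP]]; rewrite -ltNge => gx0'.
have fk0' : 0 < f k x0'.
  rewrite ltNge; apply/negP => fk; move: gx0'; rewrite ltNge fg // => i.
  by rewrite inE => /orP[/eqP ->//|/fx0'].
pose x0 := (f k x0')^-1 *: x0'.
have fk1 : f k x0 = 1 by rewrite scZ // mulVf // gt_eqF.
have fx0 i : i \in s -> f i x0 <= 0.
  by move=> si; rewrite scZ // pmulr_rle0 ?invr_gt0 // fx0'.
have gx0 : 0 < g x0 by rewrite scZ // mulr_gt0 // invr_gt0.
(* The component of x along x0 is removed, so that f k \o pr = 0. *)
pose pr x := - f k x *: x0 + x.
have [i||x fx|u u0 gE] := IH (fun i => f i \o pr) (g \o pr) us.
- move=> a x y /=; rewrite /pr !fl; ring.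
- move=> a x y /=; rewrite /pr !(fl, gl); ring.
- apply: fg => i; rewrite inE => /orP[/eqP ->|/fx//].
  by rewrite /pr fl fk1; lra.
(* Expanding [g (pr x)] and each [f j (pr x)] forces this coefficient of [f k]; it is nonnegative
   because [g x0] is positive and every [f j x0] is at most 0. *)
exists (fun i => if i == k then g x0 - \sum_(j <- s) u j * f j x0 else u i).
  move=> i; case: eqP => // _; rewrite subr_ge0 (le_trans _ (ltW gx0)) //.
  by rewrite big_seq sumr_le0 // => j sj; rewrite mulr_ge0_le0 // fx0.
move=> x; rewrite big_cons eqxx; have := gE x; rewrite /= /pr gl.
under eq_bigr do rewrite fl mulrDr mulrCA.
rewrite big_split /= -mulr_sumr => e.
have -> : \sum_(j <- s) (if j == k then g x0 - \sum_(j0 <- s) u j0 * f j0 x0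
    else u j) * f j x = \sum_(j <- s) u j * f j x.
  by apply: eq_big_seq => i si; case: eqP => // ik; rewrite -ik si in ks.
by rewrite mulrBl; lra.
Qed.

(** * Affine forms, hulls and dimension via homogeneous coordinates *)

Section AffineForms.
Context {R : realType} {k : nat}.
Implicit Types (x u : 'rV[R]_k) (c : R).

Lemma affine_formC u c x : affine_form u c x = \sum_j x 0 j * u 0 j + c.
Proof. by congr (_ + _); apply: eq_bigr => j _; rewrite mulrC. Qed.

(** At a fixed point the form is linear in its coefficients; these pairs are the vector space to
    which Farkas' lemma is applied. *)
Lemma affine_form_scalar x :
  scalar (fun y : 'rV[R]_k * R^o => affine_form y.1 y.2 x).
Proof.
move=> a [u e] [u' e'] /=; rewrite /affine_form /dotv.
rewrite [a *: e]/(a * e) mulrDr mulr_sumr addrACA -big_split /=.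
by congr (_ + _); apply: eq_bigr => j _; rewrite !mxE; ring.
Qed.

Lemma affine_form_sum u c (I : finType) (r : I -> R) (p : I -> 'rV[R]_k) :
  \sum_i r i = 1 ->
  affine_form u c (\sum_i r i *: p i) = \sum_i r i * affine_form u c (p i).
Proof.
move=> r1; rewrite /affine_form /dotv.
under [RHS]eq_bigr do rewrite mulrDr.
rewrite big_split /= -mulr_suml r1 mul1r; congr (_ + _).
under eq_bigr do rewrite summxE mulr_sumr.
rewrite exchange_big; apply: eq_bigr => i _; rewrite mulr_sumr.
by apply: eq_bigr => j _; rewrite !mxE; ring.
Qed.

Lemma affine_form_cst c x : affine_form 0 c x = c.
Proof. by rewrite affine_formC big1 ?add0r // => j _; rewrite mxE mulr0. Qed.

Lemma affine_form_delta x j : affine_form (delta_mx 0 j) 0 x = x 0 j.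
Proof.
rewrite affine_formC addr0 (bigD1 j) //= mxE !eqxx mulr1 big1 ?addr0 //.
by move=> i ij; rewrite mxE eqxx (negPf ij) mulr0.
Qed.

Lemma affine_form0 u c : affine_form u c 0 = c.
Proof. by rewrite affine_formC big1 ?add0r // => j _; rewrite mxE mul0r. Qed.

Lemma affine_formN u c x : affine_form (- u) (- c) x = - affine_form u c x.
Proof.
by rewrite /affine_form /dotv opprD -sumrN; congr (_ + _);
  apply: eq_bigr => j _; rewrite mxE mulNr.
Qed.

Lemma convex_hull_ge0 u c (S : set 'rV[R]_k) :
  (forall x, S x -> 0 <= affine_form u c x) ->
  forall x, convex_hull S x -> 0 <= affine_form u c x.
Proof.
move=> S0 x [m [p [r [Sp r0 r1 ->]]]]; rewrite affine_form_sum //.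
by apply: sumr_ge0 => i _; rewrite mulr_ge0 // S0.
Qed.

Lemma sub_convex_hull (S : set 'rV[R]_k) : S `<=` convex_hull S.
Proof.
move=> x Sx; exists 1, (fun=> x), (fun=> 1).
by split=> //; rewrite big_ord1 ?scale1r.
Qed.

(** The appended 1 turns affine hulls into row spaces, so affine dimension becomes rank minus
    one. *)
Definition homogenize x : 'rV[R]_(k + 1) := row_mx x 1%:M.

Definition homogenize_mx N (p : 'I_N -> 'rV[R]_k) : 'M[R]_(N, k + 1) :=
  \matrix_i homogenize (p i).

Lemma sum_homogenize (I : finType) (r : I -> R) (p : I -> 'rV[R]_k) :
  \sum_i r i *: homogenize (p i) = row_mx (\sum_i r i *: p i) (\sum_i r i)%:M.
Proof.
apply/rowP => j; rewrite summxE; case: (split_ordP j) => j' ->.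
  by rewrite row_mxEl summxE; apply: eq_bigr => i _; rewrite mxE row_mxEl mxE.
rewrite row_mxEr ord1 mxE mulr1n; apply: eq_bigr => i _.
by rewrite mxE row_mxEr mxE mulr1.
Qed.

Lemma affine_formE u c x :
  affine_form u c x = (homogenize x *m (row_mx u c%:M)^T) 0 0.
Proof.
rewrite tr_row_mx mul_row_col mul1mx affine_formC !mxE mulr1n; congr (_ + _).
by apply: eq_bigr => j _; rewrite !mxE.
Qed.

Lemma affine_hullP N (p : 'I_N -> 'rV[R]_k) x :
  affine_hull (range p) x <-> (homogenize x <= homogenize_mx p)%MS.
Proof.
split=> [[m [q [r [qp r1 ->]]]]|/submxP[D /esym]].
  have -> : homogenize (\sum_i r i *: q i) = \sum_i r i *: homogenize (q i).
    by rewrite sum_homogenize r1.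
  apply: summx_sub => i _; apply: scalemx_sub.
  have [j _ <-] := qp i.
  by rewrite -(rowK (fun i => homogenize (p i))) row_sub.
rewrite mulmx_sum_row; under eq_bigr do rewrite rowK.
rewrite sum_homogenize => /eq_row_mx[<- /matrixP/(_ 0 0)].
rewrite !mxE !mulr1n => r1.
by exists N, p, (D 0); split => // i; exists i.
Qed.

(** A maximal free family of rows of the homogenized matrix is an affinely independent family of
    points with the same affine hull. *)
Lemma has_dim_rank (S : set 'rV[R]_k) N (p : 'I_N -> 'rV[R]_k) m :
  (forall i, S (p i)) ->
  (forall x, S x -> (homogenize x <= homogenize_mx p)%MS) ->
  \rank (homogenize_mx p) = m.+1 -> has_dim S m.
Proof.
move=> Sp Sh rk.
have [f [ff fE]] : exists f : 'I_(\rank (homogenize_mx p)) -> 'I_N,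
    row_free (rowsub f (homogenize_mx p)) /\
    (rowsub f (homogenize_mx p) :=: homogenize_mx p)%MS.
  exists (maxrankfun (homogenize_mx p)).
  by split; [exact: maxrowsub_free|exact: eq_maxrowsub].
rewrite rk in f ff fE.
have eqf : rowsub f (homogenize_mx p) = homogenize_mx (p \o f).
  by apply/matrixP => i j; rewrite !mxE.
rewrite eqf in ff fE.
exists (p \o f); split => [r r0 rp i|i|x /Sh]; last 2 first.
- exact: Sp.
- by rewrite -fE => /affine_hullP.
have /(_ 1 (\row_i r i) 0) := row_free_inj ff.
rewrite mul0mx mulmx_sum_row; under eq_bigr do rewrite rowK mxE.
rewrite sum_homogenize /= rp r0 raddf0 row_mx0 => /(_ erefl)/rowP/(_ i).
by rewrite !mxE.
Qed.

End AffineForms.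

(** * From a supporting form to a facet of a full-dimensional polytope *)

Section SupportingFacet.
Context {R : realType} {k : nat} {I : finType}.
Variable p : I -> 'rV[R]_k.

Definition contact_set (u : 'rV[R]_k) (c : R) : {set I} :=
  [set i | affine_form u c (p i) == 0].

Let P := convex_hull (range p).
Hypothesis fullP : affine_hull P = setT.

Lemma affine_form_eq0 u c : (forall i, affine_form u c (p i) = 0) -> u = 0 /\ c = 0.
Proof.
move=> uc0.
have uP x : P x -> affine_form u c x = 0.
  move=> [m [q [r [qp r0 r1 ->]]]]; rewrite affine_form_sum // big1 // => i _.
  by have [i' _ <-] := qp i; rewrite uc0 mulr0.
have {uP} uT x : affine_form u c x = 0.
  have : affine_hull P x by rewrite fullP.
  move=> [m [q [r [qP r1 ->]]]]; rewrite affine_form_sum // big1 // => i _.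
  by rewrite uP // mulr0.
have c0 : c = 0 by rewrite -[RHS](uT 0) affine_form0.
split=> //; apply/rowP => j; rewrite mxE -[RHS](uT (delta_mx 0 j)) c0.
by rewrite -affine_form_delta /affine_form !addr0; apply: eq_bigr => i _; rewrite mulrC.
Qed.

Lemma mul_homogenize_mx_tr N (q : 'I_N -> 'rV[R]_k) u c i :
  (row_mx u c%:M *m (homogenize_mx q)^T) 0 i = affine_form u c (q i).
Proof.
rewrite affine_formE [LHS]mxE [RHS]mxE; apply: eq_bigr => j _.
by rewrite mulrC; congr (_ * _); [rewrite 2![LHS]mxE|rewrite [RHS]mxE].
Qed.

Let p_ord (i : 'I_#|I|) := p (enum_val i).

(** A vector in the left kernel of the transpose is an affine form vanishing at all [p i], hence
    zero by full dimension. *)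
Lemma rank_homogenize_mx : \rank (homogenize_mx p_ord) = k.+1.
Proof.
rewrite -mxrank_tr -[RHS]addn1; apply/eqP/inj_row_free => v.
rewrite -[v]hsubmxK [rsubmx v]mx11_scalar => vp.
have [i|-> ->] := @affine_form_eq0 (lsubmx v) (rsubmx v 0 0).
  by rewrite -[i]enum_rankK -(mul_homogenize_mx_tr p_ord) vp mxE.
by rewrite raddf0 row_mx0.
Qed.

Definition contact_mx u c :=
  homogenize_mx (fun i : 'I_#|contact_set u c| => p (enum_val i)).

(** A pivot: add a multiple of a form that vanishes on the contact set, has zero [j]-th coefficient
    and is negative at some point, until a new point makes contact. *)
Lemma enlarge_contact u c j :
  (forall i, 0 <= affine_form u c (p i)) ->
  (\rank (contact_mx u c) < k)%N ->
  exists (u' : 'rV[R]_k) c', [/\ u' 0 j = u 0 j,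
    forall i, 0 <= affine_form u' c' (p i) &
    contact_set u c \proper contact_set u' c'].
Proof.
move=> uc0 rk.
(* The kernel of [N] imposes both vanishing on the contact set and a zero [j]-th coefficient. Its
   rank is at most one more than that of [contact_mx u c], hence below [k + 1]. *)
pose N := row_mx (contact_mx u c)^T (delta_mx (lshift 1 j) 0 : 'cV[R]_(k + 1)).
have [v vN v0] : exists2 v : 'rV_(k + 1), v *m N = 0 & v != 0.
  apply: contrapT => /forall2NP h.
  have : row_free N.
    by apply: inj_row_free => v vN; have [//|/negP/negPn/eqP] := h v.
  rewrite /row_free -mxrank_tr tr_row_mx trmxK => /eqP rN.
  have := mxrank_adds_leqif (contact_mx u c) (delta_mx (lshift 1 j) 0)^T.
  move=> /(_ 0); rewrite addsmxE rN trmx_delta mxrank_delta => -[].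
  by rewrite leq_add2r leqNgt rk.
have [g [h [gj gS [i0 gi0]]]] : exists (g : 'rV[R]_k) h, [/\ g 0 j = 0,
    forall i, i \in contact_set u c -> affine_form g h (p i) = 0 &
    exists i, affine_form g h (p i) < 0].
  pose g := lsubmx v; pose h := rsubmx v 0 0.
  have vE : v = row_mx g h%:M by rewrite -[LHS]hsubmxK [rsubmx v]mx11_scalar.
  move: vN; rewrite mul_mx_row => /eqP; rewrite row_mx_eq0 => /andP[/eqP vS /eqP vj].
  have gj : g 0 j = 0.
    by move/matrixP/(_ 0 0): vj; rewrite -colE [LHS]mxE [RHS]mxE => <-; rewrite mxE.
  have gS i : i \in contact_set u c -> affine_form g h (p i) = 0.
    move=> iS; rewrite -(enum_rankK_in iS iS).
    by rewrite -(mul_homogenize_mx_tr (fun i => p (enum_val i))) -vE vS mxE.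
  have [i gi] : exists i, affine_form g h (p i) != 0.
    apply: contrapT => /forallNP gp.
    have [i|g0 h0] := @affine_form_eq0 g h; first by have /negP/negPn/eqP := gp i.
    by move: v0; rewrite vE g0 h0 raddf0 row_mx0 eqxx.
  have [|gi0|/eqP] := ltgtP (affine_form g h (p i)) 0; last by rewrite (negPf gi).
    by exists g, h; split=> //; exists i.
  exists (- g), (- h); split; first by rewrite mxE gj oppr0.
    by move=> i' /gS e; rewrite affine_formN e oppr0.
  by exists i; rewrite affine_formN oppr_lt0.
(* Ratio test: the minimal ratio is the largest multiple that keeps the form nonnegative, and [i1]
   becomes the new contact point. *)
have [i1 gi1 i1min] : exists2 i1, affine_form g h (p i1) < 0 &
    forall i, affine_form g h (p i) < 0 ->
      affine_form u c (p i1) / - affine_form g h (p i1) <=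
      affine_form u c (p i) / - affine_form g h (p i).
  have [i1 gi1 i1min] := arg_minP (P := fun i => affine_form g h (p i) < 0)
    (fun i => affine_form u c (p i) / - affine_form g h (p i)) gi0.
  by exists i1.
pose s := affine_form u c (p i1) / - affine_form g h (p i1).
have formE i : affine_form (s *: g + u) (s * h + c) (p i) =
    s * affine_form g h (p i) + affine_form u c (p i).
  exact: (affine_form_scalar (p i) s (g, h : R^o) (u, c : R^o)).
have s0 : 0 <= s by rewrite divr_ge0 // oppr_ge0 ltW.
exists (s *: g + u), (s * h + c); split.
- by rewrite !mxE gj mulr0 add0r.
- move=> i; rewrite formE; have [gi|gi] := ltP (affine_form g h (p i)) 0.
    have := i1min i gi; rewrite -/s ler_pdivlMr ?oppr_gt0 //; lra.
  by rewrite addr_ge0 // mulr_ge0.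
- apply/properP; split.
    apply/fintype.subsetP => i iS; rewrite inE formE gS // mulr0 add0r.
    by move: iS; rewrite inE.
  exists i1.
    rewrite inE formE /s; apply/eqP; field.
    by rewrite lt_eqF.
  by apply/negP => /gS e; move: gi1; rewrite e ltxx.
Qed.

Lemma contact_facet m u c : k = m.+1 -> u != 0 ->
  (forall i, 0 <= affine_form u c (p i)) -> (k <= \rank (contact_mx u c))%N ->
  facet_inward P (P `&` hyperplane u c) u c.
Proof.
move=> km u0 uc0 rk; split=> //.
  by apply: convex_hull_ge0 => _ [i _ <-].
(* Full rank [k + 1] is excluded, since the nonzero vector of coefficients annihilates every contact
   point. *)
have {}rk : \rank (contact_mx u c) = m.+1.
  apply/eqP; rewrite -km eqn_leq rk andbT -ltnS -[in ltnRHS]addn1.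
  rewrite ltn_neqAle rank_leq_col andbT -mxrank_tr; apply/negP.
  move=> /(row_free_inj (m := 1)) /(_ (row_mx u c%:M) 0) uc.
  have /eq_row_mx[] : row_mx u c%:M = row_mx 0 0.
    rewrite uc ?row_mx0 // mul0mx; apply/rowP => i.
    rewrite mul_homogenize_mx_tr mxE; apply/eqP.
    by have := enum_valP i; rewrite inE.
  by move=> e; rewrite e eqxx in u0.
exists m.
  apply: (has_dim_rank (p := p_ord)).
  - by move=> i; apply: sub_convex_hull; exists (enum_val i).
  - move=> x _; apply: submx_full.
    by rewrite /row_full rank_homogenize_mx addn1.
  - by rewrite rank_homogenize_mx km.
apply: has_dim_rank rk.
  move=> i; split; first by apply: sub_convex_hull; exists (enum_val i).
  by apply/eqP; have := enum_valP i; rewrite inE.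
move=> x [[N [q [r [qp r0 r1 ->]]]]]; rewrite /hyperplane /= affine_form_sum //.
(* A zero sum of nonnegative terms: only contact points carry nonzero weight, so they span the
   face. *)
move=> /eqP; rewrite psumr_eq0 => [/allP qr|i _]; last first.
  by have [i' _ <-] := qp i; rewrite mulr_ge0.
have -> : homogenize (\sum_i r i *: q i) = \sum_i r i *: homogenize (q i).
  by rewrite sum_homogenize r1.
apply: summx_sub => i _.
have := qr i (mem_index_enum _); rewrite /= mulf_eq0 => /orP[/eqP ->|qi].
  by rewrite scale0r sub0mx.
apply: scalemx_sub; have [i' _ pi'] := qp i; rewrite -pi' in qi *.
have i'S : i' \in contact_set u c by rewrite inE.
rewrite -(enum_rankK_in i'S i'S).
by rewrite -(rowK (fun i => homogenize (p (enum_val i)))) row_sub.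
Qed.

(** Pivoting terminates because the number of points off the hyperplane drops each time. Keeping the
    nonzero coordinate [j] prevents the form from becoming constant and later preserves the upward
    direction. *)
Lemma supporting_facet m (u : 'rV[R]_k) c j : k = m.+1 -> u 0 j != 0 ->
  (forall i, 0 <= affine_form u c (p i)) ->
  exists (u' : 'rV[R]_k) c', [/\ u' 0 j = u 0 j,
    contact_set u c \subset contact_set u' c' &
    facet_inward P (P `&` hyperplane u' c') u' c'].
Proof.
move=> km; have [n] := ubnP #|~: contact_set u c|.
elim: n u c => // n IH u c; rewrite ltnS => Sn uj uc0.
have [rk|rk] := leqP k (\rank (contact_mx u c)).
  exists u, c; split=> //; apply: contact_facet km _ uc0 rk.
  by apply: contraNneq uj => ->; rewrite mxE.
have [u1 [c1 [u1j uc1 S1]]] := enlarge_contact j uc0 rk.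
have [||| u2 [c2 [u2j S2 F2]]] := IH u1 c1; rewrite ?u1j //.
  by rewrite (leq_trans _ Sn) // proper_card // properC.
exists u2, c2; split=> //; first by rewrite u2j.
exact: fintype.subset_trans (proper_sub S1) S2.
Qed.

End SupportingFacet.

(** * The alternative between a cell and an affine relation *)

(** If no such form exists, nonnegativity at all points and nonpositivity on [L] together imply that
    the [j]-th coefficient is nonnegative; Farkas' multipliers are [r] and [s]. *)
Lemma contact_alternative (R : realType) k (I : finType) (p : I -> 'rV[R]_k)
    (L : {set I}) j :
  (exists (u : 'rV[R]_k) c, [/\ u 0 j < 0,
     forall i, 0 <= affine_form u c (p i) & L \subset contact_set p u c]) \/
  (exists r s : I -> R, [/\ forall i, 0 <= r i, forall i, 0 <= s i,
     forall i, i \notin L -> s i = 0, \sum_i r i = \sum_i s i &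
     \sum_i r i *: p i = \sum_i s i *: p i + delta_mx 0 j]).
Proof.
have [|noL] := pselect (exists (u : 'rV[R]_k) c, [/\ u 0 j < 0,
  forall i, 0 <= affine_form u c (p i) & L \subset contact_set p u c]).
  by left.
right; pose ev i (y : 'rV[R]_k * R^o) := affine_form y.1 y.2 (p i).
pose f (i : I + I) (y : 'rV[R]_k * R^o) : R :=
  match i with inl i => - ev i y | inr i => (i \in L)%:R * ev i y end.
have [|i|y fy|x x0 xE] := @farkas R _ _ (index_enum _) f
    (fun y => - y.1 0 j) (index_enum_uniq _).
- case=> i a y z; rewrite /f /ev affine_form_scalar; ring.
- by move=> y z; rewrite !mxE opprD mulrN.
- rewrite oppr_le0 leNgt; apply/negP => yj; apply: noL.
  have ev0 i : 0 <= ev i y by rewrite -oppr_le0 (fy (inl i)) ?mem_index_enum.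
  exists y.1, y.2; split=> //; apply/fintype.subsetP => i iL.
  have := fy (inr i) (mem_index_enum _); rewrite /= iL mul1r => evi.
  by rewrite inE eq_le evi ev0.
pose r i := x (inl i); pose s i := x (inr i) * (i \in L)%:R.
have xj (u : 'rV[R]_k) (c : R^o) : u 0 j =
    \sum_i r i * affine_form u c (p i) - \sum_i s i * affine_form u c (p i).
  apply: oppr_inj; rewrite (xE (u, c)) opprB big_sumType /= addrC -sumrN.
  by congr (_ + _); apply: eq_bigr => i _; rewrite /r /s /ev /=; ring.
exists r, s; split.
- by move=> i; exact: x0.
- by move=> i; rewrite mulr_ge0.
- by move=> i /negPf iL; rewrite /s iL mulr0.
(* Testing [xj] on the constant form 1 compares total weights; testing it on coordinate forms below
   compares the weighted sums of points. *)
- apply/eqP; rewrite -subr_eq0; have := xj 0 1; rewrite mxE => e.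
  rewrite [eqbRHS]e; apply/eqP; congr (_ - _); apply: eq_bigr => i _;
  by rewrite affine_form_cst mulr1.
- have sumE (q : I -> R) l : \sum_i q i * affine_form (delta_mx 0 l) 0 (p i) =
      (\sum_i q i *: p i) 0 l.
    by rewrite summxE; apply: eq_bigr => i _; rewrite affine_form_delta mxE.
  apply/rowP => l; have := xj (delta_mx 0 l) 0.
  rewrite !sumE => xl; rewrite [RHS]mxE [X in _ + X]mxE eqxx /= eq_sym.
  by move: xl; rewrite mxE eqxx /= => ->; ring.
Qed.

Lemma cell_alternative (R : realType) d (A : {fset 'rV[R]_d}) (lam : A -> R)
    (T : set (set A)) (L : {set A}) : regular_triangulation lam T ->
  (exists2 S, T S & forall a, a \in L -> S a) \/
  (exists r s : A -> R, [/\ forall a, 0 <= r a, forall a, 0 <= s a,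
     forall a, a \notin L -> s a = 0,
     \sum_a r a = \sum_a s a /\ \sum_a r a *: val a = \sum_a s a *: val a &
     \sum_a r a * lam a = \sum_a s a * lam a + 1]).
Proof.
case=> fullP _ _ TE.
have [[u [c [uj uc0 LS]]]|[r [s [r0 s0 sL rs]]]] :=
    contact_alternative (lift_point lam) L (rshift d ord0); last first.
  move=> rsE; right; exists r, s; split=> //; first split=> //.
    move/(congr1 lsubmx): rsE; rewrite raddfD !raddf_sum /=.
    under eq_bigr do rewrite linearZ /= row_mxKl.
    under [X in _ = X + _ -> _]eq_bigr do rewrite linearZ /= row_mxKl.
    move=> ->; rewrite [X in _ + X = _](_ : _ = 0) ?addr0 //.
    by apply/rowP => i; rewrite !mxE eqxx /= eq_lrshift.
  move/rowP/(_ (rshift d ord0)): rsE; rewrite mxE !summxE.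
  under eq_bigr do rewrite mxE row_mxEr mxE mulr1n.
  under [X in _ = X + _ -> _]eq_bigr do rewrite mxE row_mxEr mxE mulr1n.
  by rewrite mxE !eqxx.
left; have [||u' [c' [u'j cS F]]] :=
  supporting_facet fullP (m := d) (u := u) (c := c) (j := rshift d ord0) _ _ uc0.
- by rewrite addn1.
- by rewrite lt_eqF.
(* The inward normal [u'] keeps the negative last coordinate of [u], so the outward normal points up
   and this facet is an upper one. *)
pose F' := lifted_polytope lam `&` hyperplane u' c'.
exists (points_on lam F').
  rewrite TE /=; exists F' => //; exists (- u'); split.
    by exists c'; rewrite opprK.
  by rewrite mxE u'j oppr_gt0.
move=> a /(fintype.subsetP LS)/(fintype.subsetP cS); rewrite inE => /eqP ac.
by split=> //; apply: sub_convex_hull; exists a.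
Qed.

(** * Real powers and products of toric Bézier functions *)

(** At base 0 adding exponents could fail by cancellation; nonnegative exponents sum to 0 only if
    all are 0, where [0 ^ 0 = 1] applies. *)
Lemma prod_powR (R : realType) (I : finType) (x : R) (r : I -> R) :
  (forall i, 0 <= r i) \/ 0 < x -> \prod_i x `^ r i = x `^ (\sum_i r i).
Proof.
move=> rx; suff [] : \prod_i x `^ r i = x `^ (\sum_i r i) /\
    (0 <= \sum_i r i \/ 0 < x) by [].
elim/big_rec2: _ => [|i y2 y1 _ [-> y2x]].
  by rewrite powRr0; split=> //; left.
case: (ltP 0 x) => x0.
  rewrite powRD; last by rewrite (gt_eqF x0) implybT.
  by split=> //; right.
case: rx => [r0|]; last by rewrite ltNge x0.
case: y2x => [y20|]; last by rewrite ltNge x0.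
split; last by left; rewrite addr_ge0.
have [ry0|ry0] := eqVneq (r i + y2) 0; last by rewrite powRD // (negPf ry0).
have -> : r i = 0 by apply/eqP; move/eqP: ry0; rewrite paddr_eq0 // => /andP[].
by rewrite powRr0 mul1r add0r.
Qed.

Lemma powR_prod (R : realType) (I : finType) (x : I -> R) (r : R) :
  (forall i, 0 <= x i) -> (\prod_i x i) `^ r = \prod_i x i `^ r.
Proof.
move=> x0; suff [] : (\prod_i x i) `^ r = \prod_i x i `^ r /\ 0 <= \prod_i x i.
  by [].
elim/big_rec2: _ => [|i y2 y1 _ [<- y20]]; first by rewrite powR1.
by rewrite powRM // mulr_ge0.
Qed.

Section ToricBezier.
Context {R : realType} {d : nat} {A : {fset 'rV[R]_d}} {l : nat}.
Variables (v : 'I_l -> 'rV[R]_d) (c : 'I_l -> R).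
Hypothesis hvc : facet_forms (polytope A) v c.

Lemma facet_form_ge0 i x : polytope A x -> 0 <= affine_form (v i) (c i) x.
Proof. by rewrite (facet_forms_eq hvc); apply. Qed.

Lemma polytope_vertex (a : A) : polytope A (val a).
Proof. by apply: sub_convex_hull; exact: valP. Qed.

Lemma toric_bezier_ge0 (a : A) x : 0 <= toric_bezier v c a x.
Proof. by apply: prodr_ge0 => i _; exact: powR_ge0. Qed.

(** Take a point of [A] with nonzero weight in a convex combination giving [x]: each facet form
    vanishing at [x] vanishes there too, and contributes [0 ^ 0 = 1]. *)
Lemma toric_bezier_gt0 x : polytope A x -> exists a : A, 0 < toric_bezier v c a x.
Proof.
move=> Px; have [m [p [r [pA r0 r1 xE]]]] := Px.
have [k rk] : exists k, r k != 0.
  apply: contrapT => /forallNP rN; move: r1; rewrite big1 => [|k _].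
    by move/esym/eqP; rewrite oner_eq0.
  by have /negP/negPn/eqP := rN k.
exists [` pA k]%fset; apply: prodr_gt0 => i _.
have [h0|h0] := eqVneq (affine_form (v i) (c i) x) 0; last first.
  by rewrite powR_gt0 // lt_neqAle eq_sym h0 facet_form_ge0.
suff -> : affine_form (v i) (c i) (p k) = 0 by rewrite powRr0.
move: h0; rewrite xE affine_form_sum // => /eqP; rewrite psumr_eq0.
  by move=> /allP/(_ k (mem_index_enum _)); rewrite mulf_eq0 (negPf rk) => /eqP.
move=> k' _; rewrite mulr_ge0 // facet_form_ge0 //.
exact: (polytope_vertex [` pA k']%fset).
Qed.

(** The exponent of each facet form in the product depends only on the total weight and the weighted
    sum of the points of [A]. *)
Lemma toric_bezier_relation (r s : A -> R) x :
  (forall a, 0 <= r a) -> (forall a, 0 <= s a) -> \sum_a r a = \sum_a s a ->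
  \sum_a r a *: val a = \sum_a s a *: val a ->
  \prod_a toric_bezier v c a x `^ r a = \prod_a toric_bezier v c a x `^ s a.
Proof.
move=> r0 s0 rs rsA.
have toricE (q : A -> R) : (forall a, 0 <= q a) ->
    \prod_a toric_bezier v c a x `^ q a =
    \prod_i affine_form (v i) (c i) x `^
      (dotv (v i) (\sum_a q a *: val a) + (\sum_a q a) * c i).
  move=> q0; under eq_bigr do rewrite (powR_prod _ (fun i => powR_ge0 _ _)).
  rewrite exchange_big; apply: eq_bigr => i _ /=.
  under eq_bigr do rewrite -powRrM.
  rewrite prod_powR; last first.
    by left=> a; rewrite mulr_ge0 // facet_form_ge0 //; exact: polytope_vertex.
  congr (_ `^ _).
  transitivity (\sum_a (q a * dotv (v i) (val a) + q a * c i)).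
    by apply: eq_bigr => a _; rewrite mulrC mulrDr.
  rewrite big_split /= -mulr_suml; congr (_ + _).
  rewrite /dotv; under [RHS]eq_bigr do rewrite summxE mulr_sumr.
  rewrite exchange_big; apply: eq_bigr => a _; rewrite mulr_sumr.
  by apply: eq_bigr => j _; rewrite mxE; ring.
by rewrite !toricE // rs rsA.
Qed.

End ToricBezier.

(** * Concentration of the weights on a cell *)

Lemma ler_term_sum (R : numDomainType) (I : finType) (F : I -> R) i :
  (forall j, 0 <= F j) -> F i <= \sum_j F j.
Proof. by move=> F0; rewrite (bigD1 i) //= lerDl sumr_ge0. Qed.

(** The bound depends on [L] but not on [x]; as there are finitely many [L], it can later be made
    uniform. *)
Lemma weights_concentrate (R : realType) d (A : {fset 'rV[R]_d}) l
    (v : 'I_l -> 'rV[R]_d) (c : 'I_l -> R) (w lam : A -> R) (T : set (set A))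
    (L : {set A}) (e : R) :
  facet_forms (polytope A) v c -> (forall a, 0 < w a) ->
  regular_triangulation lam T -> 0 < e ->
  exists K : R, forall t x, 0 < t -> K < t -> polytope A x ->
    let q a := t `^ lam a * w a * toric_bezier v c a x in
    (forall a, a \in L -> e * \sum_a q a <= q a) ->
    exists2 S, T S & forall a, a \in L -> S a.
Proof.
move=> hvc w0 hT e0.
have [LS|[r [s [r0 s0 sL [rs rsA] rslam]]]] := cell_alternative L hT.
  by exists 0.
pose Wr := \prod_a w a `^ r a; pose Ws := \prod_a w a `^ s a.
have Wr0 : 0 < Wr by apply: prodr_gt0 => a _; rewrite powR_gt0.
have Ws0 : 0 < Ws by apply: prodr_gt0 => a _; rewrite powR_gt0.
pose E := \prod_a e `^ s a.
have E0 : 0 < E by apply: prodr_gt0 => a _; rewrite powR_gt0.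
(* Eliminating the common factors [G], [tau] and [B] from [qr] and [qs] gives [t * Wr * E <= Ws],
   contradicting this choice. *)
exists (Ws / (Wr * E)) => t x t0 Kt Px q qL; exfalso.
pose Q := \sum_a q a.
have q0 a : 0 <= q a.
  by rewrite /q mulr_ge0 ?toric_bezier_ge0 // mulr_ge0 ?powR_ge0 // ltW.
have Q0 : 0 < Q.
  have [a ba] := toric_bezier_gt0 hvc Px.
  rewrite /Q (bigD1 a) //= ltr_pwDl //; last exact: sumr_ge0.
  by rewrite /q !mulr_gt0 // powR_gt0.
have prodE (u : A -> R) : \prod_a (q a / Q) `^ u a =
    Q^-1 `^ (\sum_a u a) * t `^ (\sum_a u a * lam a) * (\prod_a w a `^ u a) *
    \prod_a toric_bezier v c a x `^ u a.
  rewrite -!prod_powR; [|by right; rewrite ?invr_gt0..].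
  rewrite -!big_split /=; apply: eq_bigr => a _.
  rewrite /q mulrC !powRM ?mulr_ge0 ?powR_ge0 ?toric_bezier_ge0 ?invr_ge0
    ?(ltW Q0) ?(ltW (w0 a)) //.
  by rewrite -powRrM [lam a * _]mulrC !mulrA.
have qr : \prod_a (q a / Q) `^ r a <= 1.
  apply: prodr_ile1 => a _; rewrite powR_ge0 /=.
  have <- : 1 `^ r a = 1 :> R by rewrite powR1.
  rewrite ge0_ler_powR ?nnegrE ?divr_ge0 ?(ltW Q0) // ler_pdivrMr // mul1r.
  exact: ler_term_sum.
have qs : E <= \prod_a (q a / Q) `^ s a.
  apply: ler_prod => a _; rewrite powR_ge0 /=.
  have [aL|aL] := boolP (a \in L); last by rewrite sL // !powRr0.
  rewrite ge0_ler_powR ?nnegrE ?(ltW e0) ?divr_ge0 ?(ltW Q0) //.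
  by rewrite ler_pdivlMr // qL.
move: qr qs; rewrite !prodE -/Wr -/Ws rslam rs.
rewrite (toric_bezier_relation hvc x r0 s0 rs rsA) powRD ?(gt_eqF t0) ?implybT //.
rewrite powRr1 ?(ltW t0) //.
set G := Q^-1 `^ _; set tau := t `^ _; set B := \prod_a _ => qr qs.
move: Kt; rewrite ltr_pdivrMr ?mulr_gt0 // ltNge => /negP; apply.
have := ler_wpM2l (ltW (mulr_gt0 t0 Wr0)) qs.
have := ler_wpM2l (ltW Ws0) qr; nra.
Qed.

(** * Distance estimates and the limit of the patches *)

Lemma euclid_dist_le_l1 (R : realType) n (y z : 'rV[R]_n) :
  euclid_dist y z <= \sum_j `|y 0 j - z 0 j|.
Proof.
rewrite /euclid_dist /dotv; set N := \sum_j `|_|.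
have N0 : 0 <= N by apply: sumr_ge0.
rewrite -[leRHS]ger0_norm // -sqrtr_sqr ler_wsqrtr // expr2.
rewrite {1}/N mulr_suml ler_sum // => j _.
rewrite !mxE -[leLHS]ger0_norm ?normrM; last by rewrite -expr2 sqr_ge0.
by rewrite ler_wpM2l // (ler_term_sum (F := fun j => `|y 0 j - z 0 j|)).
Qed.

Lemma convex_hull_fin (R : realType) k (I : finType) (S : set 'rV[R]_k)
    (p : I -> 'rV[R]_k) (r : I -> R) :
  (forall i, S (p i)) -> (forall i, 0 <= r i) -> \sum_i r i = 1 ->
  convex_hull S (\sum_i r i *: p i).
Proof.
move=> Sp r0 r1; exists #|I|, (fun i => p (enum_val i)), (fun i => r (enum_val i)).
split=> //; first by rewrite -r1 [RHS](reindex _ (onW_bij _ (enum_val_bij _))).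
by rewrite (reindex _ (onW_bij _ (enum_val_bij _))).
Qed.

Theorem theorem4p7 (R : realType) (d n : nat) (hdn : (d <= n)%N)
    (A : {fset 'rV[R]_d}) (hA : affine_hull [set` A] = setT)
    (w : A -> R) (hw : forall a, 0 < w a)
    (b : A -> 'rV[R]_n)
    (l : nat) (v : 'I_l -> 'rV[R]_d) (c : 'I_l -> R)
    (hvc : facet_forms (polytope A) v c)
    (lam : A -> R) (T : set (set A)) (hT : regular_triangulation lam T) :
  forall eps : R, 0 < eps ->
    exists t0 : R, forall t : R, 0 < t -> t0 < t ->
      forall y : 'rV[R]_n,
        (toric_patch (toric_bezier v c) (fun a => t `^ (lam a) * w a) b
           @` polytope A) y ->
        exists2 z : 'rV[R]_n, control_polytope b T z & euclid_dist y z <= eps.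
Proof.
move=> eps eps0.
(* For any fixed target point [a0], moving every weight below [e] there costs at most [e * M] in the
   sum of coordinate differences; [M + 1] avoids division by zero. *)
pose M : R := \sum_j \sum_a \sum_a' `|b a 0 j - b a' 0 j|.
have M0 : 0 <= M by do 3![apply: sumr_ge0 => ? _].
have M1 : 0 < M + 1 by rewrite ltr_wpDl.
pose e := eps / (M + 1); have e0 : 0 < e by rewrite divr_gt0.
have [K KP] := choice (fun L => weights_concentrate L hvc hw hT e0).
(* The set [L] varies with [t] and [x], so the threshold must dominate all the [K L]. *)
exists (\sum_L `|K L|) => t t0 Kt _ [x Px <-].
pose q a := t `^ lam a * w a * toric_bezier v c a x.
pose Q := \sum_a q a.
have q0 a : 0 <= q a.
  by rewrite /q mulr_ge0 ?toric_bezier_ge0 // mulr_ge0 ?powR_ge0 // ltW.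
have Q0 : 0 < Q.
  have [a ba] := toric_bezier_gt0 hvc Px.
  rewrite /Q (bigD1 a) //= ltr_pwDl //; last exact: sumr_ge0.
  by rewrite /q !mulr_gt0 // powR_gt0.
have p0 a : 0 <= q a / Q by rewrite divr_ge0 ?q0 // ltW.
pose L := finset (fun a => e * Q <= q a).
have [||S TS LS] := KP L t x t0 _ Px.
- apply: le_lt_trans Kt; apply: le_trans (ler_norm _) _.
  exact: (ler_term_sum (F := fun L => `|K L|)).
- by move=> a; rewrite inE.
(* A cell has [d + 1] elements, so it is nonempty even for [d = 0]. *)
have [a0 Sa0] : exists a, S a.
  case: hT => _ _ card TE; move: TS; rewrite TE => -[F uF ->].
  have := card F uF; have [->|/set0P//] := eqVneq (points_on lam F) set0.
  rewrite card_eq_sym card_eq0 => /eqP/seteqP[+ _].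
  by move=> /(_ 0)[].
(* The nearby point keeps the normalized weights but sends indices outside the cell to its vertex
   [a0]. *)
pose phi a := if `[< S a >] then a else a0.
exists (\sum_a (q a / Q) *: b (phi a)).
  exists S => //; apply: convex_hull_fin => [a|a|].
  - by rewrite /phi; case: asboolP => Sa; [exists a|exists a0].
  - exact: p0.
  - by rewrite -mulr_suml divff // gt_eqF.
apply: (le_trans (euclid_dist_le_l1 _ _)).
have : e * M <= eps.
  by rewrite /e mulrAC ler_pdivrMr // ler_wpM2l ?(ltW eps0) // lerDl.
apply: le_trans; rewrite mulr_sumr ler_sum // => j _.
rewrite /toric_patch scaler_sumr -/Q !summxE -sumrB.
apply: (le_trans (ler_norm_sum _ _ _)); rewrite mulr_sumr ler_sum // => a _.
rewrite 3!mxE mulrA [Q^-1 * _]mulrC -mulrBr.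
rewrite normrM ger0_norm ?p0 // /phi.
have [Sa|Sa] := asboolP (S a).
  by rewrite subrr normr0 mulr0 mulr_ge0 ?(ltW e0) ?sumr_ge0.
(* An index outside the cell is outside [L], so its normalized weight is small. *)
have qa : q a / Q <= e.
  rewrite ler_pdivrMr // ltW // ltNge; apply/negP => qa; apply: Sa.
  by apply: LS; rewrite inE.
rewrite ler_pM ?p0 //.
exact: (@ler_term_sum _ _ (fun a' => `|b a 0 j - b a' 0 j|) a0).
Qed.
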